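(* Let $\mathcal{H}$ be a complex Hilbert space, let $A\in\mathbb{B}(\mathcal{H})$ be a positive operator, and let $\mathbb{A}=\begin{bmatrix} A & 0\\ 0 & A\end{bmatrix}$ on $\mathcal{H}\oplus\mathcal{H}$. Let $T, S\in\mathbb{B}_{A^{1/2}}(\mathcal{H})$. Then (i) $w_{\mathbb{A}}\left(\begin{bmatrix} T & S \\ T & S \end{bmatrix}\right) \leq w_{A}(T+S) + \frac{1}{2}\|T-S\|_{A}$; (ii) $w_{\mathbb{A}}\left(\begin{bmatrix} T & S \\ -T & -S \end{bmatrix}\right) \leq w_{A}(T-S) + \frac{1}{2}\|T+S\|_{A}$.
   Context: $\mathbb{B}(\mathcal{H})$ is the algebra of bounded linear operators on the complex Hilbert space $\mathcal{H}$. A positive operator $A$ (i.e. $\langle Ax,x\rangle\ge 0$ for all $x$) induces the semi-inner product $\langle x,y\rangle_A=\langle Ax,y\rangle$ and the seminorm $\|x\|_A=\sqrt{\langle x,x\rangle_A}$. $\mathbb{B}_{A^{1/2}}(\mathcal{H})=\{T\in\mathbb{B}(\mathcal{H}): \exists c>0,\ \|Tx\|_A\le c\|x\|_A\ \forall x\in\mathcal{H}\}$. For $T\in\mathbb{B}_{A^{1/2}}(\mathcal{H})$ the $A$-operator seminorm is $\|T\|_A=\sup\{\|Tx\|_A: x\in\mathcal{H},\ \|x\|_A=1\}$ and the $A$-numerical radius is $w_A(T)=\sup\{|\langle Tx,x\rangle_A|: x\in\mathcal{H},\ \|x\|_A=1\}$. The same definitions with $\mathcal{H}\oplus\mathcal{H}$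 and $\mathbb{A}$ in place of $\mathcal{H}$ and $A$ give $\langle\cdot,\cdot\rangle_{\mathbb{A}}$, $\|\cdot\|_{\mathbb{A}}$ and $w_{\mathbb{A}}(\cdot)$, where $\langle x,y\rangle_{\mathbb{A}}=\langle x_1,y_1\rangle_A+\langle x_2,y_2\rangle_A$ for $x=(x_1,x_2)$, $y=(y_1,y_2)$. $2\times2$ block matrices of operators on $\mathcal{H}$ act on $\mathcal{H}\oplus\mathcal{H}$ in the usual way. *)

(* Defs.v *)
From HB Require Import structures.
From mathcomp Require Import all_boot all_order all_algebra.
From mathcomp Require Import all_classical all_reals all_analysis.
From mathcomp Require Import complex ring.

Set Implicit Arguments.
Unset Strict Implicit.
Unset Printing Implicit Defensive.
Import Order.TTheory GRing.Theory Num.Theory numFieldNormedType.Exports.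

Local Open Scope classical_set_scope.
Local Open Scope ring_scope.

(* [inner] is linear in its first argument, conjugate-linear in the second. *)
HB.mixin Record CompleteNormedModule_isHilbert (R : realType) H
    of CompleteNormedModule R[i] H := {
  inner : {dot H for (@Num.conj R[i])};
  inner_norm : forall x : H, inner x x = `|x| ^+ 2
}.

#[short(type="hilbertType")]
HB.structure Definition Hilbert (R : realType) :=
  {H of CompleteNormedModule R[i] H & CompleteNormedModule_isHilbert R H}.

(* An alias of the product is needed because [(H * H)%type] canonically carries
   the max norm, which does not come from an inner product. *)
Definition hsum (R : realType) (H : hilbertType R) : Type := (H * H)%type.

HB.instance Definition _ (R : realType) (H : hilbertType R) :=
  GRing.Lmodule.copy (hsum H) (H * H)%type.

Section DirectSum.
Variables (R : realType) (H : hilbertType R).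
Implicit Types x y z : hsum H.

Definition hsum_inner x y : R[i] := inner x.1 y.1 + inner x.2 y.2.

Definition hsum_norm x : R[i] := sqrtC (`|x.1| ^+ 2 + `|x.2| ^+ 2).

Let hsum_inner_bilinear :
  bilinear_for (GRing.Scale.Law.clone _ _ *%R _)
    (GRing.Scale.Law.clone _ _ (@Num.conj R[i] \; *%R) _) hsum_inner.
Proof.
split=> [z a x y|z a x y]; rewrite /hsum_inner /=.
- by rewrite !linearPl /=; ring.
- by rewrite !linearPr /=; ring.
Qed.

HB.instance Definition _ := bilinear_isBilinear.Build R[i] (hsum H) (hsum H)
  R[i] _ _ hsum_inner hsum_inner_bilinear.

Let hsum_inner_herm x y :
  hsum_inner x y = (-1) ^+ false * Num.conj (hsum_inner y x).
Proof.
rewrite /hsum_inner expr0 mul1r rmorphD /=.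
by rewrite (hermC inner x.1) (hermC inner x.2) expr0 !mul1r.
Qed.

HB.instance Definition _ := isHermitianSesquilinear.Build R[i] (hsum H) false
  (@Num.conj R[i]) hsum_inner hsum_inner_herm.

Let hsum_inner_gt0 x : x != 0 -> 0 < hsum_inner x x.
Proof.
move=> x0; rewrite /hsum_inner !inner_norm lt_neqAle eq_sym addr_ge0 ?exprn_ge0//.
rewrite andbT paddr_eq0 ?exprn_ge0// !expf_eq0 /= !normr_eq0.
by case: x x0 => x1 x2 /=; apply: contraNN => /andP[/eqP -> /eqP ->].
Qed.

HB.instance Definition _ :=
  isDotProduct.Build R[i] (hsum H) hsum_inner hsum_inner_gt0.

Let sq_ge0 x : 0 <= `|x.1| ^+ 2 + `|x.2| ^+ 2.
Proof. by rewrite addr_ge0 ?exprn_ge0. Qed.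

Let hsum_norm_ge0 x : 0 <= hsum_norm x.
Proof. by rewrite sqrtC_ge0. Qed.

Let hsum_normD x y : hsum_norm (x + y) <= hsum_norm x + hsum_norm y.
Proof.
rewrite -(@ler_pXn2r _ 2)// ?nnegrE ?addr_ge0//.
rewrite sqrrD !sqrtCK /=.
apply: (@le_trans _ _ ((`|x.1| + `|y.1|) ^+ 2 + (`|x.2| + `|y.2|) ^+ 2)).
  by rewrite lerD// ler_pXn2r ?nnegrE ?addr_ge0// ler_normD.
suff : `|x.1| * `|y.1| + `|x.2| * `|y.2| <= hsum_norm x * hsum_norm y.
  rewrite -(@ler_pM2l _ 2)// -subr_ge0 => h; rewrite -subr_ge0.
  by apply: le_trans h _; rewrite le_eqVlt; apply/orP; left; apply/eqP; ring.
rewrite -(@ler_pXn2r _ 2)// ?nnegrE ?addr_ge0 ?mulr_ge0//.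
rewrite exprMn !sqrtCK -subr_ge0.
have : 0 <= (`|x.1| * `|y.2| - `|x.2| * `|y.1|) ^+ 2.
  by rewrite real_exprn_even_ge0// realB// realM.
by move=> h; apply: le_trans h _; rewrite le_eqVlt; apply/orP; left; apply/eqP; ring.
Qed.

Let hsum_normZ (a : R[i]) x : hsum_norm (a *: x) = `|a| * hsum_norm x.
Proof.
rewrite /hsum_norm /= !normrZ !exprMn -mulrDr rootCMl ?exprn_ge0//.
by rewrite sqrCK.
Qed.

Let hsum_norm0_eq0 x : hsum_norm x = 0 -> x = 0.
Proof.
move=> /eqP; rewrite sqrtC_eq0 paddr_eq0 ?exprn_ge0// !expf_eq0 /= !normr_eq0.
by case: x => x1 x2 /= /andP[/eqP -> /eqP ->].
Qed.

HB.instance Definition _ := Lmodule_isNormed.Build R[i] (hsum H)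
  hsum_normD hsum_normZ hsum_norm0_eq0.

Lemma hsum_normE x : `|x| ^+ 2 = `|x.1| ^+ 2 + `|x.2| ^+ 2.
Proof. exact: sqrtCK. Qed.

Let hsum_cauchy_cvg (F : set_system (hsum H)) :
  ProperFilter F -> cauchy F -> cvg F.
Proof.
move=> FF /cauchy_ballP Fc.
have le1 x : `|x.1| <= `|x|.
  rewrite -(@ler_pXn2r _ 2)// ?nnegrE// (hsum_normE x) lerDl exprn_ge0//.
have le2 x : `|x.2| <= `|x|.
  rewrite -(@ler_pXn2r _ 2)// ?nnegrE// (hsum_normE x) lerDr exprn_ge0//.
have c1 : cvg ((fun x : hsum H => x.1 : H) @ F).
  apply: cauchy_cvg; apply/cauchy_ballP => e e0.
  rewrite !near_map2; apply: filterS (Fc e e0) => -[x y] /=.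
  by rewrite -!ball_normE /=; apply: le_lt_trans; exact: (le1 (x - y)).
have c2 : cvg ((fun x : hsum H => x.2 : H) @ F).
  apply: cauchy_cvg; apply/cauchy_ballP => e e0.
  rewrite !near_map2; apply: filterS (Fc e e0) => -[x y] /=.
  by rewrite -!ball_normE /=; apply: le_lt_trans; exact: (le2 (x - y)).
move: c1 c2 => /cvg_ex[/= l1 /cvgrPdist_lt h1] /cvg_ex[/= l2 /cvgrPdist_lt h2].
apply/cvg_ex; pose l : hsum H := (l1, l2); exists l.
apply/cvgrPdist_lt => e e0.
have e20 : 0 < e / 2 by rewrite divr_gt0.
near=> x.
have d1 : `|l1 - x.1| < e / 2 by near: x; exact: h1.
have d2 : `|l2 - x.2| < e / 2 by near: x; exact: h2.
rewrite -(@ltr_pXn2r _ 2)// ?nnegrE// ?(ltW e0)//.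
have -> : `|l - x| ^+ 2 = `|l1 - x.1| ^+ 2 + `|l2 - x.2| ^+ 2 by exact: hsum_normE.
apply: (@le_lt_trans _ _ ((`|l1 - x.1| + `|l2 - x.2|) ^+ 2)).
  by rewrite sqrrD addrAC lerDl mulrn_wge0// mulr_ge0.
by rewrite ltr_pXn2r ?nnegrE ?addr_ge0// ?ltW// [ltRHS]splitr ltrD.
Unshelve. all: by end_near. Qed.

HB.instance Definition _ := Uniform_isComplete.Build (hsum H) hsum_cauchy_cvg.

Let hsum_inner_norm x : hsum_inner x x = `|x| ^+ 2.
Proof. by rewrite hsum_normE /hsum_inner !inner_norm. Qed.

HB.instance Definition _ :=
  CompleteNormedModule_isHilbert.Build R (hsum H) hsum_inner_norm.

End DirectSum.

Section SemiHilbert.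
Variables (R : realType) (H : hilbertType R).
Implicit Types (A T : H -> H) (x y : H).

Definition bounded_op T : Prop :=
  exists M : R, forall x, `|T x| <= (M%:C)%C * `|x|.

(* In [R[i]], [0 <= z] means that [z] is real and nonnegative. *)
Definition positive_op A : Prop := forall x, 0 <= inner (A x) x.

Definition A_inner A x y : R[i] := inner (A x) y.

Definition A_norm A x : R := Num.sqrt (complex.Re (A_inner A x x)).

(* Membership in B_{A^{1/2}}(H), for a linear map T. *)
Definition A_bounded_op A T : Prop :=
  bounded_op T /\
  exists2 c : R, 0 < c & forall x, A_norm A (T x) <= c * A_norm A x.

(* [sup] is the supremum in [R], with [sup set0 = 0]: when the A-unit sphere is
   empty (A = 0), both suprema below are 0. *)
Definition A_opnorm A T : R :=
  sup [set A_norm A (T x) | x in [set x | A_norm A x = 1]].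

Definition A_numradius A T : R :=
  sup [set ComplexField.Normc.normc (A_inner A (T x) x)
      | x in [set x | A_norm A x = 1]].

End SemiHilbert.

Definition block_op (R : realType) (H : hilbertType R)
    (T11 T12 T21 T22 : H -> H) : hsum H -> hsum H :=
  fun x => (T11 x.1 + T12 x.2, T21 x.1 + T22 x.2).

Lemma A_inner_block_diag (R : realType) (H : hilbertType R) (A : H -> H)
    (x y : hsum H) :
  A_inner (block_op A \0 \0 A) x y = A_inner A x.1 y.1 + A_inner A x.2 y.2.
Proof. by rewrite /A_inner /= /hsum_inner /= addr0 add0r. Qed.

(* Main.v *)
Require Import Defs.
From HB Require Import structures.
From mathcomp Require Import all_boot all_order all_algebra.
From mathcomp Require Import all_classical all_reals all_analysis.
From mathcomp Require Import complex ring lra.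

Set Implicit Arguments.
Unset Strict Implicit.
Unset Printing Implicit Defensive.
Import Order.TTheory GRing.Theory Num.Theory numFieldNormedType.Exports.

Local Open Scope classical_set_scope.
Local Open Scope ring_scope.

(* For x = (x1, x2), put u = x1 + x2 and v = x1 - x2.  Then
   <[T S; T S] x, x> = 1/2 (<(T + S) u, u>_A + <(T - S) v, u>_A), and by the
   parallelogram law |u|_A^2 + |v|_A^2 = 2 on the unit sphere; hence
   |u|_A^2 <= 2 and |u|_A |v|_A <= 1, which bound the two terms.  Part (ii) is
   the same with u exchanged with v and T + S with T - S. *)

(** * Sesquilinearity of the [A]-form *)

Lemma A_innerDl (R : realType) (H : hilbertType R) (A : {linear H -> H})
    (x y z : H) : A_inner A (x + y) z = A_inner A x z + A_inner A y z.
Proof. by rewrite /A_inner !linearD linearDl. Qed.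

Lemma A_innerDr (R : realType) (H : hilbertType R) (A : H -> H) (x y z : H) :
  A_inner A z (x + y) = A_inner A z x + A_inner A z y.
Proof. by rewrite /A_inner linearDr. Qed.

Lemma A_innerZl (R : realType) (H : hilbertType R) (A : {linear H -> H})
    (a : R[i]) (x y : H) : A_inner A (a *: x) y = a * A_inner A x y.
Proof. by rewrite /A_inner linearZ linearZl_LR. Qed.

Lemma A_innerZr (R : realType) (H : hilbertType R) (A : H -> H)
    (a : R[i]) (x y : H) : A_inner A x (a *: y) = (a^*)%C * A_inner A x y.
Proof. by rewrite /A_inner linearZr_LR. Qed.

Lemma A_innerNl (R : realType) (H : hilbertType R) (A : {linear H -> H})
    (x y : H) : A_inner A (- x) y = - A_inner A x y.
Proof. by rewrite /A_inner (linearN A) linearNl. Qed.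

Lemma A_innerNr (R : realType) (H : hilbertType R) (A : H -> H) (x y : H) :
  A_inner A x (- y) = - A_inner A x y.
Proof. by rewrite /A_inner linearNr. Qed.

(** * Positivity: the [A]-seminorm and the Cauchy-Schwarz inequality *)

Lemma A_norm_ge0 (R : realType) (H : hilbertType R) (A : H -> H) (x : H) :
  0 <= A_norm A x.
Proof. exact: sqrtr_ge0. Qed.

Lemma A_norm_sqr (R : realType) (H : hilbertType R) (A : H -> H)
    (A_pos : positive_op A) (x : H) :
  A_norm A x ^+ 2 = complex.Re (A_inner A x x).
Proof.
by rewrite sqr_sqrtr//; move: (A_pos x); rewrite /A_inner lecE => /andP[].
Qed.

Lemma A_inner_self (R : realType) (H : hilbertType R) (A : H -> H)
    (A_pos : positive_op A) (x : H) :
  A_inner A x x = ((A_norm A x ^+ 2)%:C)%C.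
Proof.
rewrite (A_norm_sqr A_pos); move: (A_pos x); rewrite -/(A_inner A x x) lecE.
by case: (A_inner A x x) => a b /= /andP[/eqP -> _].
Qed.

(** Polarization: positivity makes the form real on the diagonal. At [x + y] this forces the
    imaginary parts of [<x, y>_A] and [<y, x>_A] to be opposite, and at [x + i y] it forces their
    real parts to agree. *)
Lemma A_inner_conj (R : realType) (H : hilbertType R) (A : {linear H -> H})
    (A_pos : positive_op A) (x y : H) : A_inner A y x = ((A_inner A x y)^*)%C.
Proof.
have real z : complex.Im (A_inner A z z) = 0 by rewrite A_inner_self.
have h1 := real (x + y); have h2 := real (x + 'i%C *: y).
move: h1 h2; rewrite !(A_innerDl, A_innerDr, A_innerZl, A_innerZr) /=.
rewrite !A_inner_self//.
case: (A_inner A x y) => a b; case: (A_inner A y x) => c d /=.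
by move=> h1 h2; apply/eqP; rewrite eq_complex /=; apply/andP; split; apply/eqP; lra.
Qed.

Lemma A_norm_sqrD (R : realType) (H : hilbertType R) (A : {linear H -> H})
    (A_pos : positive_op A) (x y : H) :
  A_norm A (x + y) ^+ 2 =
  A_norm A x ^+ 2 + 2 * complex.Re (A_inner A x y) + A_norm A y ^+ 2.
Proof.
rewrite !A_norm_sqr// !(A_innerDl, A_innerDr) (A_inner_conj A_pos x y) !raddfD /=.
by case: (A_inner A x y) => a b /=; ring.
Qed.

Lemma normc_sqr (R : rcfType) (z : R[i]) :
  ComplexField.Normc.normc z ^+ 2 = complex.Re z ^+ 2 + complex.Im z ^+ 2.
Proof. by case: z => a b; rewrite /= sqr_sqrtr// addr_ge0 ?sqr_ge0. Qed.

Lemma normc_ge0 (R : rcfType) (z : R[i]) : 0 <= ComplexField.Normc.normc z.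
Proof. by case: z => a b; rewrite /= sqrtr_ge0. Qed.

Lemma normc_real (R : rcfType) (r : R) :
  ComplexField.Normc.normc (r%:C)%C = `|r|.
Proof. by rewrite /= expr0n addr0 sqrtr_sqr. Qed.

Lemma A_normZ (R : realType) (H : hilbertType R) (A : {linear H -> H})
    (A_pos : positive_op A) (a : R[i]) (x : H) :
  A_norm A (a *: x) = ComplexField.Normc.normc a * A_norm A x.
Proof.
apply/eqP; rewrite -(@eqrXn2 _ 2)// ?mulr_ge0 ?A_norm_ge0 ?normc_ge0//; apply/eqP.
rewrite exprMn !A_norm_sqr// normc_sqr A_innerZl A_innerZr A_inner_self//.
by case: a => a b /=; ring.
Qed.

Lemma A_normN (R : realType) (H : hilbertType R) (A : {linear H -> H})
    (x : H) : A_norm A (- x) = A_norm A x.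
Proof. by rewrite /A_norm A_innerNl A_innerNr opprK. Qed.

Lemma A_CauchySchwarz (R : realType) (H : hilbertType R) (A : {linear H -> H})
    (A_pos : positive_op A) (x y : H) :
  ComplexField.Normc.normc (A_inner A x y) <= A_norm A x * A_norm A y.
Proof.
rewrite -(@ler_pXn2r _ 2)// ?nnegrE ?mulr_ge0 ?A_norm_ge0 ?normc_ge0//.
set n := ComplexField.Normc.normc _; rewrite exprMn.
(* Nonnegativity of the A-seminorm of [x - r <x, y>_A y]. *)
have key (r : R) : 0 <= A_norm A x ^+ 2 - 2 * r * n ^+ 2
    + r ^+ 2 * n ^+ 2 * A_norm A y ^+ 2.
  have := sqr_ge0 (A_norm A (x + (- (r%:C)%C * A_inner A x y) *: y)).
  rewrite A_norm_sqrD// A_normZ// A_innerZr exprMn !normc_sqr.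
  move/le_trans; apply; rewrite le_eqVlt; apply/orP; left; apply/eqP.
  by case: (A_inner A x y) => a b /=; ring.
(* The form is only semidefinite. If [|y|_A = 0], the bound [key] is affine in [r]; were [n]
   nonzero, the [r] chosen below would give it the value -1. *)
have [y0|y0] := eqVneq (A_norm A y ^+ 2) 0.
  have [->|n0] := eqVneq (n ^+ 2) 0; first by rewrite mulr_ge0 ?sqr_ge0.
  have := key ((A_norm A x ^+ 2 + 1) / (2 * n ^+ 2)).
  have -> : 2 * ((A_norm A x ^+ 2 + 1) / (2 * n ^+ 2)) * n ^+ 2 =
    A_norm A x ^+ 2 + 1 by field; rewrite expf_eq0 /= in n0.
  by rewrite y0; lra.
have ygt0 : 0 < A_norm A y ^+ 2 by rewrite lt_neqAle eq_sym y0 sqr_ge0.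
(* This [r] minimizes the quadratic when [n] is nonzero. *)
have := key ((A_norm A y ^+ 2)^-1).
have -> : A_norm A x ^+ 2 - 2 * (A_norm A y ^+ 2)^-1 * n ^+ 2 +
   (A_norm A y ^+ 2)^-1 ^+ 2 * n ^+ 2 * A_norm A y ^+ 2 =
   A_norm A x ^+ 2 - n ^+ 2 / A_norm A y ^+ 2.
  by field; rewrite expf_eq0 /= in y0.
by rewrite subr_ge0 ler_pdivrMr.
Qed.

Lemma ler_A_normD (R : realType) (H : hilbertType R) (A : {linear H -> H})
    (A_pos : positive_op A) (x y : H) :
  A_norm A (x + y) <= A_norm A x + A_norm A y.
Proof.
rewrite -(@ler_pXn2r _ 2)// ?nnegrE ?addr_ge0 ?A_norm_ge0// A_norm_sqrD//.
suff : complex.Re (A_inner A x y) <= A_norm A x * A_norm A y by lra.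
apply: le_trans (A_CauchySchwarz A_pos x y).
apply: le_trans (ler_norm _) _.
rewrite -(@ler_pXn2r _ 2)// ?nnegrE ?normc_ge0// normc_sqr.
by rewrite real_normK ?num_real// lerDl sqr_ge0.
Qed.

(** * [A]-bounded operators and the suprema they define *)

Lemma A_bounded_opD (R : realType) (H : hilbertType R) (A : {linear H -> H})
    (T S : H -> H) : positive_op A -> A_bounded_op A T -> A_bounded_op A S ->
  A_bounded_op A (T \+ S).
Proof.
move=> A_pos [[M TM] [c c0 Tc]] [[N SN] [d d0 Sd]]; split.
  exists (M + N) => x; rewrite rmorphD mulrDl.
  by apply: le_trans (ler_normD _ _) _; rewrite lerD.
exists (c + d) => [|x]; first exact: addr_gt0.
by rewrite mulrDl; apply: le_trans (ler_A_normD A_pos _ _) _; rewrite lerD.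
Qed.

Lemma A_bounded_opB (R : realType) (H : hilbertType R) (A : {linear H -> H})
    (T S : H -> H) : positive_op A -> A_bounded_op A T -> A_bounded_op A S ->
  A_bounded_op A (T \- S).
Proof.
move=> A_pos Tb [[N SN] [d d0 Sd]].
apply: (@A_bounded_opD _ _ _ T (\- S)) => //; split.
  by exists N => x; rewrite /= normrN.
by exists d => // x; rewrite /= A_normN.
Qed.

(** If the image is empty or unbounded above, [sup] takes its default value 0; otherwise it
    dominates some nonnegative [f x]. *)
Lemma sup_image_ge0 (R : realType) (U : Type) (f : U -> R) (E : set U) :
  (forall x, 0 <= f x) -> 0 <= sup [set f x | x in E].
Proof.
move=> f0; have [E_sup|/sup_out -> //] := pselect (has_sup [set f x | x in E]).
have [[y [x Ex _]] E_ub] := E_sup.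
by apply: le_trans (f0 x) _; apply: ub_le_sup => //; exists x.
Qed.

(** Rescale [x] to the [A]-unit sphere, where the constant [c] bounds the set under the supremum. If
    [|x|_A = 0], no rescaling is possible, but [A]-boundedness gives [|T x|_A = 0]. *)
Lemma A_norm_le_opnorm (R : realType) (H : hilbertType R)
    (A T : {linear H -> H}) (A_pos : positive_op A) (Tb : A_bounded_op A T)
    (x : H) : A_norm A (T x) <= A_opnorm A T * A_norm A x.
Proof.
have [_ [c c0 Tc]] := Tb.
have [x0|x0] := eqVneq (A_norm A x) 0.
  by have := Tc x; rewrite x0 !mulr0.
have xgt0 : 0 < A_norm A x by rewrite lt_neqAle eq_sym x0 A_norm_ge0.
have e : ComplexField.Normc.normc (((A_norm A x)^-1)%:C)%C = (A_norm A x)^-1.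
  by rewrite normc_real ger0_norm ?invr_ge0 ?A_norm_ge0.
rewrite -ler_pdivrMr// mulrC -{1}e -A_normZ// -linearZ.
apply: ub_le_sup; first by exists c => _ [y y1 <-]; rewrite -(mulr1 c) -y1.
by eexists; last reflexivity; rewrite /= A_normZ// e mulVf.
Qed.

(** The same rescaling, now homogeneous of degree 2. Cauchy-Schwarz settles the case [|x|_A = 0] and
    shows that the set under the supremum is bounded by [c]. *)
Lemma A_inner_le_numradius (R : realType) (H : hilbertType R)
    (A T : {linear H -> H}) (A_pos : positive_op A) (Tb : A_bounded_op A T)
    (x : H) :
  ComplexField.Normc.normc (A_inner A (T x) x) <=
  A_numradius A T * A_norm A x ^+ 2.
Proof.
have [_ [c c0 Tc]] := Tb.
have [x0|x0] := eqVneq (A_norm A x) 0.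
  by have := A_CauchySchwarz A_pos (T x) x; rewrite x0 expr0n !mulr0.
have xgt0 : 0 < A_norm A x by rewrite lt_neqAle eq_sym x0 A_norm_ge0.
have e : ComplexField.Normc.normc (((A_norm A x)^-1)%:C)%C = (A_norm A x)^-1.
  by rewrite normc_real ger0_norm ?invr_ge0 ?A_norm_ge0.
rewrite -ler_pdivrMr ?exprn_gt0//.
apply: ub_le_sup.
  exists c => _ [y y1 <-]; apply: le_trans (A_CauchySchwarz A_pos _ _) _.
  by rewrite y1 mulr1 -(mulr1 c) -y1.
exists ((((A_norm A x)^-1)%:C)%C *: x); first by rewrite /= A_normZ// e mulVf.
rewrite linearZ A_innerZl A_innerZr !ComplexField.Normc.normcM e.
suff -> : (((A_norm A x)^-1)%:C^*)%C = (((A_norm A x)^-1)%:C)%C :> R[i].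
  by rewrite e; field.
by rewrite /= oppr0.
Qed.

(** * The direct sum and the final estimates *)

Lemma A_parallelogram (R : realType) (H : hilbertType R) (A : {linear H -> H})
    (A_pos : positive_op A) (x y : H) :
  A_norm A (x + y) ^+ 2 + A_norm A (x - y) ^+ 2 =
  2 * (A_norm A x ^+ 2 + A_norm A y ^+ 2).
Proof.
rewrite !A_norm_sqrD// A_normN A_innerNr.
by case: (A_inner _ _ _) => a b /=; ring.
Qed.

Lemma A_norm_block_diag_sqr (R : realType) (H : hilbertType R)
    (A : {linear H -> H}) (A_pos : positive_op A) (x : hsum H) :
  A_norm (block_op A \0 \0 A) x ^+ 2 = A_norm A x.1 ^+ 2 + A_norm A x.2 ^+ 2.
Proof.
rewrite {1}/A_norm A_inner_block_diag !A_inner_self//= sqr_sqrtr//.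
by rewrite addr_ge0 ?sqr_ge0.
Qed.

(** The estimate shared by both parts: [P] and [Q] are [T + S] and [T - S] in one order or the
    other. The factor 1/2 cancels against [|u|_A^2 <= 2] in the first term and survives in the
    second, where [|u|_A |v|_A <= 1]. *)
Lemma half_A_inner_le (R : realType) (H : hilbertType R)
    (A P Q : {linear H -> H}) (A_pos : positive_op A)
    (Pb : A_bounded_op A P) (Qb : A_bounded_op A Q) (u v : H) :
  A_norm A u ^+ 2 + A_norm A v ^+ 2 = 2 ->
  ComplexField.Normc.normc (2^-1 * (A_inner A (P u) u + A_inner A (Q v) u)) <=
  A_numradius A P + 2^-1 * A_opnorm A Q.
Proof.
move=> uv.
have -> : 2^-1 = ((2^-1)%:C)%C :> R[i] by rewrite fmorphV rmorph_nat.
rewrite ComplexField.Normc.normcM normc_real ger0_norm//.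
have w0 : 0 <= A_numradius A P by apply: sup_image_ge0 => x; exact: normc_ge0.
have o0 : 0 <= A_opnorm A Q by apply: sup_image_ge0 => x; exact: A_norm_ge0.
have hP := A_inner_le_numradius A_pos Pb u.
have hQ : ComplexField.Normc.normc (A_inner A (Q v) u) <=
    A_opnorm A Q * A_norm A v * A_norm A u.
  apply: le_trans (A_CauchySchwarz A_pos _ _) _.
  by rewrite ler_wpM2r ?A_norm_ge0// A_norm_le_opnorm.
have hu : A_numradius A P * A_norm A u ^+ 2 <= A_numradius A P * 2.
  by rewrite ler_wpM2l// -uv lerDl sqr_ge0.
have hv : A_opnorm A Q * (A_norm A v * A_norm A u) <= A_opnorm A Q * 1.
  (* Arithmetic-geometric mean inequality under the constraint [uv]. *)
  rewrite ler_wpM2l//; have := sqr_ge0 (A_norm A u - A_norm A v).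
  by rewrite sqrrB; lra.
have := le_normcD (A_inner A (P u) u) (A_inner A (Q v) u).
by rewrite mulrA in hv; lra.
Qed.

(** Reduces the numerical radius to a pointwise bound, with the unit sphere rewritten in the sum and
    difference of the components. The condition [0 <= b] covers an empty sphere, whose supremum is
    0. *)
Lemma A_numradius_block_le (R : realType) (H : hilbertType R)
    (A : {linear H -> H}) (A_pos : positive_op A) (B : hsum H -> hsum H)
    (b : R) : 0 <= b ->
  (forall x : hsum H,
     A_norm A (x.1 + x.2) ^+ 2 + A_norm A (x.1 - x.2) ^+ 2 = 2 ->
     ComplexField.Normc.normc (A_inner A (B x).1 x.1 + A_inner A (B x).2 x.2)
       <= b) ->
  A_numradius (block_op A \0 \0 A) B <= b.
Proof.
move=> b0 hb; rewrite /A_numradius.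
set E := [set _ | _ in _]; have [->|/set0P E0] := eqVneq E set0.
  by rewrite sup0.
apply: ge_sup => // _ [x x1 <-]; rewrite A_inner_block_diag; apply: hb.
rewrite /= in x1.
by rewrite A_parallelogram// -A_norm_block_diag_sqr// x1 expr1n mulr1.
Qed.

Theorem corollary2p8 (R : realType) (H : hilbertType R)
    (A T S : {linear H -> H})
    (A_bounded : bounded_op A) (A_pos : positive_op A)
    (T_A_bounded : A_bounded_op A T) (S_A_bounded : A_bounded_op A S) :
  A_numradius (block_op A \0 \0 A) (block_op T S T S)
    <= A_numradius A (T \+ S) + 2^-1 * A_opnorm A (T \- S)
  /\
  A_numradius (block_op A \0 \0 A) (block_op T S (\- T) (\- S))
    <= A_numradius A (T \- S) + 2^-1 * A_opnorm A (T \+ S).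
(* These ensure that the suprema for [T + S] and [T - S] are true upper bounds. *)
have Db := A_bounded_opD A_pos T_A_bounded S_A_bounded.
have Bb := A_bounded_opB A_pos T_A_bounded S_A_bounded.
have bound_ge0 (P Q : H -> H) : 0 <= A_numradius A P + 2^-1 * A_opnorm A Q.
  rewrite addr_ge0 ?mulr_ge0//; apply: sup_image_ge0 => x.
    exact: normc_ge0.
  exact: A_norm_ge0.
split; apply: A_numradius_block_le => // x hx.
(* With [u = x1 + x2] and [v = x1 - x2], both moduli are of the same number, since
   [(T + S) u + (T - S) v = 2 (T x1 + S x2)]. *)
- apply: le_trans (half_A_inner_le A_pos Db Bb hx); rewrite le_eqVlt.
  apply/orP; left; apply/eqP; congr ComplexField.Normc.normc.
  rewrite /= !(linearD, linearN) !(A_innerDl, A_innerDr, A_innerNl, A_innerNr).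
  by field.
(* Now [u = x1 - x2] and [v = x1 + x2]: the form equals [<T x1 + S x2, x1 - x2>_A], and
   [(T - S) u + (T + S) v = 2 (T x1 + S x2)]. *)
- rewrite addrC in hx.
  apply: le_trans (half_A_inner_le A_pos Bb Db hx); rewrite le_eqVlt.
  apply/orP; left; apply/eqP; congr ComplexField.Normc.normc.
  rewrite /= !(linearD, linearN) !(A_innerDl, A_innerDr, A_innerNl, A_innerNr).
  by field.
Qed.
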